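(* For $i\ge 0$ let $l_i=2^{2\cdot 2^i+4}$, $m_i=2^{8\cdot 2^i}$, $n_i=2^{10\cdot 2^i}$. Define finite words over $\{0,1\}$ by $u_0=0$, $v_0=1$ and, for all $i\ge 0$, $u_{i+1}=u_i^{m_i}v_i^{l_i}$ and $v_{i+1}=u_i^{m_i}v_i^{n_i}$, and let $u$ be the infinite word having every $u_i$ as a prefix. Then the letters of $u$ do not admit uniform frequencies.
   Context: For a finite word $w$ and a letter $x\in\{0,1\}$, $|w|$ is the length of $w$ and $|w|_x$ the number of occurrences of $x$ in $w$; $w^n$ is the concatenation of $n$ copies of $w$. The letters of an infinite word $u$ over $\{0,1\}$ are said to admit uniform frequencies if for each letter $x\in\{0,1\}$ and every sequence $(w_n)$ of factors (finite blocks of consecutive letters) of $u$ with $\lim_{n\to\infty}|w_n|=\infty$, the limit $\lim_{n\to\infty}\frac{|w_n|_x}{|w_n|}$ exists. *)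

(* Defs.v *)
From mathcomp Require Import all_boot all_order all_algebra.
From mathcomp Require Import all_classical all_reals all_analysis.
Import Order.TTheory GRing.Theory Num.Theory numFieldNormedType.Exports.

Set Implicit Arguments.
Unset Strict Implicit.
Unset Printing Implicit Defensive.

Local Open Scope classical_set_scope.

(* The alphabet {0,1} is bool: false is the letter 0, true is the letter 1. *)
Definition word := seq bool.
Definition infword := nat -> bool.

Definition wpow (w : word) (n : nat) : word := flatten (nseq n w).

Definition infprefix (w : word) (x : infword) : Prop := w = mkseq x (size w).

Definition inffactor (w : word) (x : infword) : Prop :=
  exists k : nat, w = mkseq (fun j => x (k + j)) (size w).

Definition admits_uniform_frequencies (R : realType) (x : infword) : Prop :=
  forall (a : bool) (w : nat -> word),
    (forall n, inffactor (w n) x) ->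
    size (w n) @[n --> \oo] --> \oo ->
    cvgn (fun n => (count_mem a (w n))%:R / (size (w n))%:R : R)%R.

Definition l_ (i : nat) : nat := 2 ^ (2 * 2 ^ i + 4).
Definition m_ (i : nat) : nat := 2 ^ (8 * 2 ^ i).
Definition n_ (i : nat) : nat := 2 ^ (10 * 2 ^ i).

Fixpoint u_ (i : nat) : word :=
  if i is j.+1 then wpow (u_ j) (m_ j) ++ wpow (v_ j) (l_ j) else [:: false]
with v_ (i : nat) : word :=
  if i is j.+1 then wpow (u_ j) (m_ j) ++ wpow (v_ j) (n_ j) else [:: true].

Lemma size_wpow w n : size (wpow w n) = n * size w.
Proof. by elim: n => [|n IH] //; rewrite /wpow /= size_cat IH mulSn. Qed.

Lemma u_S i : u_ i.+1 = wpow (u_ i) (m_ i) ++ wpow (v_ i) (l_ i).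
Proof. by []. Qed.

Lemma m_gt1 i : 1 < m_ i.
Proof. by rewrite /m_ -{1}(expn0 2) ltn_exp2l // muln_gt0 expn_gt0. Qed.

Lemma prefix_u_S i : prefix (u_ i) (u_ i.+1).
Proof.
rewrite u_S; case: (m_ i) (m_gt1 i) => // m _.
by rewrite /wpow /= -catA prefix_prefix.
Qed.

Lemma prefix_u_ i j : i <= j -> prefix (u_ i) (u_ j).
Proof.
move=> /subnK <-; elim: (j - i) => [|k IH]; first exact: prefix_refl.
by apply: prefix_trans IH _; rewrite addSn prefix_u_S.
Qed.

Lemma size_u_gt i : i < size (u_ i).
Proof.
elim: i => // i IH; rewrite u_S size_cat size_wpow.
apply: (@leq_trans (2 * size (u_ i))).
  by rewrite mul2n -addnn -addn1 leq_add // (leq_ltn_trans (leq0n i)).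
by rewrite (leq_trans _ (leq_addr _ _)) // leq_mul2r m_gt1 orbT.
Qed.

(* The infinite word having every u_ i as a prefix exists and is unique, so a
   statement about every x with this property concerns exactly one word. *)
Lemma limit_word_exists_unique :
  exists! x : infword, forall i, infprefix (u_ i) x.
Proof.
have nth_u i j k : i <= j -> k < size (u_ i) ->
    nth false (u_ j) k = nth false (u_ i) k.
  by move=> /prefix_u_ /prefixP[s ->] ki; rewrite nth_cat ki.
exists (fun k => nth false (u_ k) k); split=> [i|y yP].
  apply: (@eq_from_nth _ false) => [|k ki]; rewrite ?size_mkseq ?nth_mkseq //.
  case: (leqP i k) => [ik|/ltnW ki']; first by rewrite (nth_u _ _ _ ik).
  by rewrite (nth_u _ _ _ ki') // size_u_gt.
by apply/funext => k; rewrite yP nth_mkseq // size_u_gt.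
Qed.

(* Main.v *)
Require Import Defs.
From mathcomp Require Import all_boot all_order all_algebra.
From mathcomp Require Import all_classical all_reals all_analysis.
From mathcomp Require Import zify lra.
Import Order.TTheory GRing.Theory Num.Theory numFieldNormedType.Exports.

(** With a = 2 ^ 2 ^ i we have l_i = 16 a^2, m_i = a^8, n_i = a^10, and a is
    squared when i increases. Inductively |u_i| <= |v_i| < a^2 |u_i|, so u_{i+1}
    consists mostly of copies of u_i and v_{i+1} mostly of copies of v_i: the
    frequency of 1 moves by O(1/a^2) at each step. It starts at 1/5 for u_1
    and at 4/5 for v_1, hence stays below 2/5 along (u_i) and above 3/5
    along (v_i), whereas all these words are factors of the limit word. *)

Lemma count_wpow (P : pred bool) (w : word) n :
  count P (wpow w n) = n * count P w.
Proof. by elim: n => [|n IH] //; rewrite /wpow /= count_cat IH mulSn. Qed.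

Lemma inffactor_cat (s1 s2 s3 : word) (x : infword) :
  infprefix (s1 ++ s2 ++ s3) x -> inffactor s2 x.
Proof.
move=> s_pref; exists (size s1).
apply: (@eq_from_nth _ false) => [|j ltj]; rewrite ?size_mkseq ?nth_mkseq //.
move/(congr1 (fun s => nth false s (size s1 + j))): s_pref.
rewrite nth_mkseq; last by rewrite !size_cat ltn_add2l ltn_addr.
by rewrite nth_cat ltnNge leq_addr /= addKn nth_cat ltj.
Qed.

Definition a_ (i : nat) : nat := 2 ^ 2 ^ i.

Lemma a_S i : a_ i.+1 = a_ i * a_ i.
Proof. by rewrite /a_ expnS mul2n -addnn expnD. Qed.

Lemma a_ge2 i : 2 <= a_ i.
Proof. by rewrite /a_ -{1}(expn1 2) leq_exp2l // expn_gt0. Qed.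

Lemma a_ge4 i : 4 <= a_ i.+1.
Proof. by rewrite a_S (leq_mul (a_ge2 i) (a_ge2 i)). Qed.

Lemma l_E i : l_ i = 16 * a_ i ^ 2.
Proof. by rewrite /l_ /a_ expnD mulnC -expnM (mulnC 2). Qed.

Lemma m_E i : m_ i = a_ i ^ 8.
Proof. by rewrite /m_ /a_ -expnM mulnC. Qed.

Lemma n_E i : n_ i = a_ i ^ 10.
Proof. by rewrite /n_ /a_ -expnM mulnC. Qed.

Lemma size_u_S i :
  size (u_ i.+1) = a_ i ^ 8 * size (u_ i) + 16 * a_ i ^ 2 * size (v_ i).
Proof. by rewrite u_S size_cat !size_wpow m_E l_E. Qed.

Lemma size_v_S i :
  size (v_ i.+1) = a_ i ^ 8 * size (u_ i) + a_ i ^ 10 * size (v_ i).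
Proof. by rewrite -m_E -n_E /= size_cat !size_wpow. Qed.

Lemma ones_u_S i : count_mem true (u_ i.+1) =
  a_ i ^ 8 * count_mem true (u_ i) + 16 * a_ i ^ 2 * count_mem true (v_ i).
Proof. by rewrite u_S count_cat !count_wpow m_E l_E. Qed.

Lemma ones_v_S i : count_mem true (v_ i.+1) =
  a_ i ^ 8 * count_mem true (u_ i) + a_ i ^ 10 * count_mem true (v_ i).
Proof. by rewrite -m_E -n_E /= count_cat !count_wpow. Qed.

(** Both successors share the block of copies of [u_ i]; the rest is [16 a^2 <= a^10], true since
    [a >= 2]. *)
Lemma leq_size_uv i : size (u_ i) <= size (v_ i).
Proof.
case: i => // i; rewrite size_u_S size_v_S leq_add2l leq_mul2r; apply/orP; right.
have a2 := a_ge2 i.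
have -> : 10 = 8 + 2 by [].
by rewrite expnD leq_mul2r; apply/orP; right; apply: (@leq_trans (2 ^ 8));
  rewrite ?leq_exp2r.
Qed.

(* The summand [size (u_ i)] absorbs the lower-order term in the induction. *)
Lemma size_v_bound i :
  size (v_ i) + size (u_ i) <= a_ i ^ 2 * size (u_ i).
Proof.
elim: i => // i IH; rewrite size_u_S size_v_S a_S.
move: (a_ge2 i) IH.
set a := a_ i; set U := size (u_ i); set V := size (v_ i) => a2 IH.
have IH' := leq_mul (leqnn (a ^ 10)) IH.
have h1 : a ^ 8 * U * 4 <= a ^ 10 * U.
  by rewrite (expnD a 8 2) mulnAC leq_mul2r leq_mul2l (@leq_exp2r 2 a 2) // a2 !orbT.
have h2 : 16 * a ^ 2 * V <= 16 * (a * a) ^ 2 * (a ^ 2) * V.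
  by rewrite leq_mul2r -mulnA leq_mul2l leq_pmull ?orbT // expn_gt0 muln_gt0; lia.
lia.
Qed.

(* That is, |u|_1 / |u| <= 2/5 - 2/a^2: the slack 2/a^2 pays for the growth of
   the frequency in all later steps; symmetrically for v below. *)
Lemma ones_u_bound i :
  5 * a_ i.+1 ^ 2 * count_mem true (u_ i.+1) + 10 * size (u_ i.+1)
    <= 2 * a_ i.+1 ^ 2 * size (u_ i.+1).
Proof.
(* The induction starts at index 1, with 64 ones among 320 letters and [a = 4]; at index 0, where
   [a = 2], the inequality fails. *)
elim: i => [|i IH]; first by rewrite ones_u_S size_u_S; vm_compute.
rewrite ones_u_S size_u_S (a_S i.+1).
move: (size_v_bound i.+1) (count_size (pred1 true) (v_ i.+1)) (a_ge4 i) IH.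
set a := a_ _; set U := size (u_ _); set V := size (v_ _); set p := count _ (u_ _).
set q := count _ (v_ _) => VU qV a4 IH.
(* After this scaling the [a^12] terms match the goal. The leftover slack [10 a^10 U] pays for the
   ones in the copies of [v], through [q <= V <= a^2 U], and for the new slack. *)
have IH' := leq_mul (leqnn (a ^ 10)) IH.
have h1 := leq_mul (leqnn (a ^ 6)) (leq_trans (leq_addr _ _) VU).
have h2 := leq_mul (leqnn (a ^ 6)) qV.
have a16 : 16 <= a ^ 2 by rewrite (@leq_exp2r 4 a 2).
have h3 := leq_mul a16 (leqnn (a ^ 8 * U)).
have a256 : 256 <= a ^ 4 by rewrite (@leq_exp2r 4 a 4).
have h4 := leq_mul a256 (leqnn (a ^ 2 * V)).
lia.
Qed.

Lemma ones_v_bound i :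
  3 * a_ i.+1 ^ 2 * size (v_ i.+1) + 10 * size (v_ i.+1)
    <= 5 * a_ i.+1 ^ 2 * count_mem true (v_ i.+1).
Proof.
elim: i => [|i IH]; first by rewrite ones_v_S size_v_S; vm_compute.
rewrite ones_v_S size_v_S (a_S i.+1).
move: (leq_size_uv i.+1) (a_ge4 i) IH.
set a := a_ _; set U := size (u_ _); set V := size (v_ _); set p := count _ (u_ _).
set q := count _ (v_ _) => UV a4 IH.
(* The ones in the copies of [u] are bounded below by 0; the slack [10 a^12 V] covers their length
   cost [3 a^12 U], since [U <= V], and the new slack. *)
have IH' := leq_mul (leqnn (a ^ 12)) IH.
have h1 := leq_mul (leqnn (a ^ 12)) UV.
have h2 := leq_mul (leqnn (a ^ 8)) UV.
have a16 : 16 <= a ^ 2 by rewrite (@leq_exp2r 4 a 2).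
have h3 := leq_mul a16 (leqnn (a ^ 10 * V)).
have h4 := leq_mul a16 (leqnn (a ^ 8 * V)).
lia.
Qed.

Section LimitWord.
Context {x : infword} (hx : forall i, infprefix (u_ i) x).

Lemma inffactor_u i : inffactor (u_ i) x.
Proof. by apply: (@inffactor_cat [::] _ [::]); rewrite cats0; exact: hx. Qed.

Lemma inffactor_v i : inffactor (v_ i) x.
Proof.
have := hx i.+1; rewrite u_S.
have : 0 < l_ i by rewrite expn_gt0.
(* The first copy of [v_ i] in [u_ i.+1] directly follows the block of copies of [u_ i]. *)
by case: (l_ i) => // l _; apply: inffactor_cat.
Qed.

End LimitWord.

Local Open Scope ring_scope.
Local Open Scope classical_set_scope.

Lemma freq_u_le (R : realType) i :
  (count_mem true (u_ i.+1))%:R / (size (u_ i.+1))%:R <= 2 / 5 :> R.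
Proof.
have U0 : (0 < size (u_ i.+1))%N := leq_ltn_trans (leq0n _) (size_u_gt _).
rewrite ler_pdivrMr ?ltr0n // mulrAC ler_pdivlMr // -!natrM ler_nat.
have a0 : (0 < a_ i.+1 ^ 2)%N by rewrite !expn_gt0.
rewrite -(leq_pmul2l a0); have := ones_u_bound i; lia.
Qed.

Lemma freq_v_ge (R : realType) i :
  3 / 5 <= (count_mem true (v_ i.+1))%:R / (size (v_ i.+1))%:R :> R.
Proof.
have V0 : (0 < size (v_ i.+1))%N.
  exact: leq_trans (leq_ltn_trans (leq0n _) (size_u_gt _)) (leq_size_uv _).
rewrite ler_pdivlMr ?ltr0n // mulrAC ler_pdivrMr // -!natrM ler_nat.
have a0 : (0 < a_ i.+1 ^ 2)%N by rewrite !expn_gt0.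
rewrite -(leq_pmul2l a0); have := ones_v_bound i; lia.
Qed.

Theorem lemma4p4 (R : realType) (x : infword)
  (hx : forall i : nat, infprefix (u_ i) x) :
  ~ admits_uniform_frequencies R x.
Proof.
(* Interleaving the two families makes a single sequence of factors whose frequencies oscillate. *)
move=> /(_ true (fun n => if odd n then v_ n else u_ n)) freq_cvg.
(* [1 / 10] is half the gap between 2/5 and 3/5. *)
have /cvgrPdist_lt /(_ (1 / 10)) : cvgn (fun n : nat =>
    (count_mem true (if odd n then v_ n else u_ n))%:R
      / (size (if odd n then v_ n else u_ n))%:R : R).
  apply: freq_cvg => [n|].
    by case: ifP => _; [exact: inffactor_v | exact: inffactor_u].
  apply/cvgnyPge => N; near=> n.
  have Nu : (N <= size (u_ n))%N.
    by apply: leq_trans (ltnW (size_u_gt n)); near: n; exists N.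
  by case: ifP => // _; exact: leq_trans Nu (leq_size_uv n).
case=> [|N _ close]; first lra.
(* [N.+1] rather than [N] keeps both indices positive, as the frequency bounds require. *)
have /close : (N <= N.+1.*2)%N by rewrite -addnn; lia.
have /close : (N <= N.+1.*2.+1)%N by rewrite -addnn; lia.
rewrite /= odd_double /= !doubleS.
have := freq_v_ge R N.*2.+2; have := freq_u_le R N.*2.+1.
move: (_%:R / (size (u_ _))%:R) (_%:R / (size (v_ _))%:R) => f g /=.
rewrite !ltr_distl => ? ? /andP[? ?] /andP[? ?]; lra.
Unshelve. all: by end_near.
Qed.
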